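(* Let $\lambda>0$ and assume that $0<p-1=q<1$ and $\sigma\not\equiv 0$ on $\partial S$. If $\lambda<\lambda_{p,0}$, then every solution $u$ of the problem $$\begin{cases} u_t(x,t)=\Delta_{p,\omega}u(x,t)+\lambda|u(x,t)|^{q-1}u(x,t), & (x,t)\in S\times(0,\infty),\\ \mu(z)\frac{\partial u}{\partial_p n}(z,t)+\sigma(z)|u(z,t)|^{p-2}u(z,t)=0, & (z,t)\in\partial S\times[0,\infty),\\ u(x,0)=u_0(x)\ge 0, & x\in\overline S,\end{cases}$$ vanishes in finite time $T>0$.
   Context: Network: $G=(V,E)$ is a finite, connected, simple graph with a weight $\omega:V\times V\to[0,\infty)$, i.e. $\omega(x,x)=0$, $\omega(x,y)=\omega(y,x)$, and $\omega(x,y)>0$ iff $x\sim y$ ($x,y$ adjacent). $S$ is a connected induced subgraph of $G$ (identified with its vertex set), $\partial S=\{z\in V\setminus S: y\sim z\text{ for some }y\in S\}$, and $\overline S=S\cup\partial S$ is the network whose edges are the edges of $G$ with at least one endpoint in $S$ (so there are no edges between two vertices of $\partial S$ in $\overline S$, and $\omega$ is regarded as $0$ there). Operators, for $u:\overline S\to\mathbb R$, with the convention $|a|^{p-2}a=0$ if $a=0$: $\Delta_{p,\omega}u(x)=\sum_{y\in\overline S}|u(x)-u(y)|^{p-2}[u(y)-u(x)]\omega(x,y)$ for $x\in\overline S$, and $\frac{\partial u}{\partial_p n}(z)=\sum_{y\in S}|u(z)-u(y)|^{p-2}[u(z)-u(y)]\omega(z,y)$ for $z\in\partial S$. For functions of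 $(x,t)$ they act in the variable $x$. Boundary coefficients: $\mu,\sigma:\partial S\to[0,\infty)$ with $\mu(z)+\sigma(z)>0$ for all $z\in\partial S$; $\Gamma=\{z\in\partial S:\mu(z)>0\}$. First eigenvalue: $$\lambda_{p,0}=\min_{u\in\mathcal A}\frac{\frac12\sum_{x,y\in\overline S}|u(x)-u(y)|^p\omega(x,y)+\sum_{z\in\Gamma}\frac{\sigma(z)}{\mu(z)}|u(z)|^p}{\sum_{x\in S}|u(x)|^p},$$ where $\mathcal A=\{u:\overline S\to\mathbb R: u\not\equiv0\text{ in }S,\ u=0\text{ on }\partial S\setminus\Gamma\}$ and the sum over $\Gamma$ is $0$ if $\Gamma=\emptyset$. One has $\lambda_{p,0}>0$ when $\sigma\not\equiv0$. There is a function $\phi_0$ on $\overline S$, positive on $S\cup\Gamma$, with $-\Delta_{p,\omega}\phi_0=\lambda_{p,0}|\phi_0|^{p-2}\phi_0$ on $S$ and $\mu\frac{\partial\phi_0}{\partial_p n}+\sigma|\phi_0|^{p-2}\phi_0=0$ on $\partial S$ (known facts). Solution: a function $u$ on $\overline S\times[0,T_{\max})$, $0<T_{\max}\le\infty$, with $u(x,\cdot)$ continuous on $[0,T_{\max})$ and differentiable in $(0,T_{\max})$ for each $x\in\overline S$, satisfying the problem for times in $[0,T_{\max})$, where $[0,T_{\max})$ is a maximal interval of existence. The solution vanishes in finite time if there is a finite $T>0$ in its interval of existence with $\sum_{x\in S}u^2(x,T)=0$. *)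

(* Defs.v *)
From HB Require Import structures.
From mathcomp Require Import all_boot all_order all_algebra.
From mathcomp Require Import all_classical all_reals all_analysis.

Set Implicit Arguments.
Unset Strict Implicit.
Unset Printing Implicit Defensive.

Import Order.TTheory GRing.Theory Num.Theory.
Import numFieldNormedType.Exports.

Local Open Scope classical_set_scope.
Local Open Scope ring_scope.

Record network (R : realType) (V : finType) := Network {
  adj : rel V;
  weight : V -> V -> R;
  adj_irr : irreflexive adj;
  adj_sym : symmetric adj;
  adj_connected : forall x y, connect adj x y;
  weight_ge0 : forall x y, 0 <= weight x y;
  weight_diag : forall x, weight x x = 0;
  weight_sym : forall x y, weight x y = weight y x;
  weight_gt0 : forall x y, (0 < weight x y) = adj x y
}.

Definition connected_subgraph (R : realType) (V : finType) (G : network R V)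
    (S : {set V}) : Prop :=
  S != finset.set0 /\
  forall x y, x \in S -> y \in S ->
    connect [rel a b | [&& a \in S, b \in S & adj G a b]] x y.

(* Functions on the closed subnetwork are represented by functions on V; their
   values outside [nclosure G S] are never used. *)
Definition nboundary (R : realType) (V : finType) (G : network R V)
    (S : {set V}) : {set V} :=
  [set z | (z \notin S) && [exists y in S, adj G y z]]%SET.

Definition nclosure (R : realType) (V : finType) (G : network R V)
    (S : {set V}) : {set V} :=
  (S :|: nboundary G S)%SET.

(* The closed subnetwork has no edge between two boundary vertices. *)
Definition cweight (R : realType) (V : finType) (G : network R V)
    (S : {set V}) (x y : V) : R :=
  if (x \in S) || (y \in S) then weight G x y else 0.

(* Since [0 * _ = 0], the terms |a|^(r) a below vanish at a = 0 also when the
   exponent r is negative. *)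
Definition plaplacian (R : realType) (V : finType) (G : network R V)
    (S : {set V}) (p : R) (u : V -> R) (x : V) : R :=
  \sum_(y in nclosure G S)
    `|u x - u y| `^ (p - 2) * (u y - u x) * cweight G S x y.

Definition pnormal_derivative (R : realType) (V : finType) (G : network R V)
    (S : {set V}) (p : R) (u : V -> R) (z : V) : R :=
  \sum_(y in S) `|u z - u y| `^ (p - 2) * (u z - u y) * cweight G S z y.

Definition boundary_coefficients (R : realType) (V : finType)
    (G : network R V) (S : {set V}) (mu sigma : V -> R) : Prop :=
  forall z, z \in nboundary G S ->
    [/\ 0 <= mu z, 0 <= sigma z & 0 < mu z + sigma z].

Definition Gamma (R : realType) (V : finType) (G : network R V)
    (S : {set V}) (mu : V -> R) : {set V} :=
  [set z in nboundary G S | 0 < mu z]%SET.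

Definition admissible (R : realType) (V : finType) (G : network R V)
    (S : {set V}) (mu : V -> R) : set (V -> R) :=
  [set u | (exists2 x, x \in S & u x != 0) /\
           (forall z, z \in nboundary G S -> z \notin Gamma G S mu ->
              u z = 0)].

Definition rayleigh (R : realType) (V : finType) (G : network R V)
    (S : {set V}) (mu sigma : V -> R) (p : R) (u : V -> R) : R :=
  (2^-1 * (\sum_(x in nclosure G S) \sum_(y in nclosure G S)
             `|u x - u y| `^ p * cweight G S x y)
   + \sum_(z in Gamma G S mu) sigma z / mu z * `|u z| `^ p)
  / \sum_(x in S) `|u x| `^ p.

(* The infimum is attained, so it is the minimum; see
   [first_eigenvalue_minimum]. *)
Definition first_eigenvalue (R : realType) (V : finType) (G : network R V)
    (S : {set V}) (mu sigma : V -> R) (p : R) : R :=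
  inf [set rayleigh G S mu sigma p u | u in admissible G S mu].

Lemma first_eigenvalue_minimum (R : realType) (V : finType) (G : network R V)
    (S : {set V}) (mu sigma : V -> R) (p : R) (phi : V -> R) :
  admissible G S mu phi ->
  (forall u, admissible G S mu u ->
     rayleigh G S mu sigma p phi <= rayleigh G S mu sigma p u) ->
  first_eigenvalue G S mu sigma p = rayleigh G S mu sigma p phi.
Proof.
move=> phiA phi_min; apply/eqP; rewrite eq_le; apply/andP; split.
  apply: ge_inf; last by exists phi.
  by exists (rayleigh G S mu sigma p phi) => _ [u uA <-]; exact: phi_min.
apply: lb_le_inf; first by exists (rayleigh G S mu sigma p phi), phi.
by move=> _ [u uA <-]; exact: phi_min.
Qed.

Definition time_interval (R : realType) (T : \bar R) : set R :=
  [set t | 0 <= t /\ (t%:E < T)%E].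

Definition solves_on (R : realType) (V : finType) (G : network R V)
    (S : {set V}) (mu sigma : V -> R) (p q lambda : R) (u0 : V -> R)
    (T : \bar R) (u : V -> R -> R) : Prop :=
  [/\ forall x, x \in nclosure G S ->
        {within time_interval T, continuous (u x)} /\
        (forall t : R, 0 < t -> (t%:E < T)%E -> derivable (u x) t 1),
      forall x (t : R), x \in S -> 0 < t -> (t%:E < T)%E ->
        derive1 (u x) t = plaplacian G S p (u ^~ t) x
                      + lambda * (`|u x t| `^ (q - 1) * u x t),
      forall z (t : R), z \in nboundary G S -> time_interval T t ->
        mu z * pnormal_derivative G S p (u ^~ t) z
        + sigma z * (`|u z t| `^ (p - 2) * u z t) = 0
    & forall x, x \in nclosure G S -> u x 0 = u0 x].

Definition is_solution (R : realType) (V : finType) (G : network R V)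
    (S : {set V}) (mu sigma : V -> R) (p q lambda : R) (u0 : V -> R)
    (Tmax : \bar R) (u : V -> R -> R) : Prop :=
  [/\ (0 < Tmax)%E,
      solves_on G S mu sigma p q lambda u0 Tmax u
    & ~ exists (T : \bar R) (v : V -> R -> R),
        [/\ (Tmax < T)%E,
            solves_on G S mu sigma p q lambda u0 T v
          & forall x t, x \in nclosure G S -> time_interval Tmax t ->
              v x t = u x t]].

Definition vanishes_in_finite_time (R : realType) (V : finType) (S : {set V})
    (Tmax : \bar R) (u : V -> R -> R) : Prop :=
  exists T : R, [/\ 0 < T, (T%:E < Tmax)%E & \sum_(x in S) u x T ^+ 2 = 0].

(* Main.v *)
Require Import Defs.
From HB Require Import structures.
From mathcomp Require Import all_boot all_order all_algebra.
From mathcomp Require Import all_classical all_reals all_analysis.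
From mathcomp Require Import ring lra.

Set Implicit Arguments.
Unset Strict Implicit.
Unset Printing Implicit Defensive.

Import Order.TTheory GRing.Theory Num.Theory.
Import numFieldNormedType.Exports.

Local Open Scope classical_set_scope.
Local Open Scope ring_scope.

(** The proof is an energy argument on [y(t) = sum_S u(x, t)^2].  Multiplying the
    equation by [u] and summing by parts, the boundary condition turns the
    boundary terms into those of the Rayleigh quotient, whence
    [y' <= - 2 (lambda_{p,0} - lambda) sum_S |u|^p].  Since [p < 2] the p-norm
    dominates the 2-norm, so [y' <= - k y^(p/2)] with [k > 0] and [p/2 < 1], and
    [y^(1 - p/2)], which loses at least a fixed amount per unit of time, has to
    reach [0] ([finite_extinction]).

    This settles the matter once the solution is known to be global, and most of
    the work goes into that: if the maximal time [T] of existence were finite, the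
    solution, bounded by its energy, would extend beyond [T]
    ([solution_extends]).  The boundary values are functions of the interior
    ones: the boundary condition at [z] says that [u z] is the point [s] where
    [sum_i c_i |s - f_i|^(p-2) (s - f_i)] vanishes, a p-mean of the neighbouring
    values and of [0].  Eliminating them leaves an ordinary differential equation
    on [S] whose right-hand side is continuous, though not Lipschitz, as
    [p - 1 < 1].

    - [peano]: a continuous bounded vector field has a solution through every
      point, obtained as the limit of Euler schemes along an ultrafilter.
    - [left_expansion]: the bounded solution has a limit at [T], and its left
      derivative there is the one that the restarted solution has on the right.
    - [pmean_derivable]: a p-mean of differentiable functions is differentiable,
      so that the boundary values of the continuation are differentiable in time
      as well.  This holds even where the mean meets some of the values, which is
      exactly where [|a|^(p-2) a] fails to be differentiable. *)

(** * The odd power function *)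

Section OddPower.
Variables (R : realType) (r : R).
Implicit Types a b : R.

(** With [r = p - 1] this is [|a|^(p-2) a] of the p-Laplacian. *)
Definition spow a : R := `|a| `^ (r - 1) * a.

Lemma spow0 : spow 0 = 0.
Proof. by rewrite /spow mulr0. Qed.

Lemma spowN a : spow (- a) = - spow a.
Proof. by rewrite /spow normrN mulrN. Qed.

Lemma spowM a b : spow (a * b) = spow a * spow b.
Proof. by rewrite /spow normrM powRM// mulrACA. Qed.

Hypothesis r0 : 0 < r.

Lemma ger0_spow a : 0 <= a -> spow a = a `^ r.
Proof. by move=> a0; rewrite /spow ger0_norm// mulrC mulr_powRB1. Qed.

Lemma spow_gt0 a : 0 < a -> 0 < spow a.
Proof. by move=> a0; rewrite ger0_spow ?ltW// powR_gt0. Qed.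

Lemma spow_mul_self a : spow a * a = `|a| `^ (r + 1).
Proof.
have [->|a0] := eqVneq a 0.
  by rewrite mulr0 normr0 powR0// gt_eqF// addr_gt0.
rewrite /spow -mulrA -expr2 -real_normK ?num_real// -powR_mulrn//.
rewrite -powRD; last by rewrite normr_eq0 a0 implybT.
by congr powR; ring.
Qed.

Lemma norm_spow a : `|spow a| = spow `|a|.
Proof. by rewrite /spow normrM normr_id ger0_norm// powR_ge0. Qed.

Lemma spow_increasing : {homo spow : a b / a < b}.
Proof.
have pos a b : 0 <= a -> a < b -> spow a < spow b.
  move=> a0 ab; have b0 := le_trans a0 (ltW ab).
  by rewrite !ger0_spow// gt0_ltr_powR// nnegrE.
move=> a b ab; case: (leP 0 a) => a0; first exact: pos.
case: (ltP 0 b) => b0.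
  by rewrite (@lt_trans _ _ 0) ?spow_gt0// -oppr_gt0 -spowN spow_gt0 ?oppr_gt0.
by rewrite -ltrN2 -!spowN pos ?oppr_ge0 ?ltrN2.
Qed.

Lemma ler_spow : {mono spow : a b / a <= b}.
Proof. exact/le_mono/spow_increasing. Qed.

Lemma ltr_spow : {mono spow : a b / a < b}.
Proof. exact/leW_mono/ler_spow. Qed.

Lemma is_derive_spow a : a != 0 -> is_derive a 1 spow (r * `|a| `^ (r - 1)).
Proof.
have pos b : 0 < b -> is_derive b 1 spow (r * `|b| `^ (r - 1)).
  move=> b0; rewrite gtr0_norm//.
  have e : \forall x \near b, x `^ r = spow x.
    near=> x; rewrite ger0_spow//; apply/ltW.
    by near: x; exact: lt_nbhsr.
  exact: (near_eq_is_derive e (is_derive1_powR r b0)).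
move=> a0; case: (ltP 0 a) => a0'; first exact: pos.
have na0 : 0 < - a by rewrite oppr_gt0 lt_neqAle a0.
have -> : spow = - (spow \o -%R).
  by apply/funext => x /=; rewrite opprfctE /= spowN opprK.
apply: is_derive_eq.
  apply: is_deriveN; apply: is_derive1_comp; exact: pos.
by rewrite normrN mulrN1 opprK.
Unshelve. all: by end_near. Qed.

Lemma spow_continuous : continuous spow.
Proof.
move=> a; have [->|a0] := eqVneq a 0; last first.
  apply/differentiable_continuous/derivable1_diffP.
  by have [] := is_derive_spow a0.
rewrite /continuous_at spow0; apply/cvgrPdist_lt => e e0.
exists (e `^ r^-1) => /=; first by rewrite powR_gt0.
move=> b /=; rewrite !sub0r !normrN => h.
rewrite norm_spow ger0_spow// -(@powRr1 _ e) ?ltW//.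
rewrite -(@mulVf _ r) ?gt_eqF// powRrM gt0_ltr_powR// nnegrE ?powR_ge0//.
Qed.

End OddPower.

(** * Weighted p-means *)

Lemma cvg_sumr (R : realType) (T : Type) (F : set_system T) (FF : Filter F)
    (I : finType) (P : pred I) (f : I -> T -> R) (l : I -> R) :
  (forall i, P i -> f i t @[t --> F] --> l i) ->
  \sum_(i | P i) f i t @[t --> F] --> \sum_(i | P i) l i.
Proof. by move=> h; apply: cvg_big => //; exact: add_continuous. Qed.

Section PMean.
Variables (R : realType) (r : R) (I : finType).
Implicit Types (c f : I -> R) (s : R).

Definition balance c f s : R := \sum_i c i * spow r (s - f i).

Definition is_weight c := (forall i, 0 <= c i) /\ exists i, 0 < c i.

(** The minimiser of [s |-> sum_i c i |s - f i|^(r+1)], characterised by its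
    Euler equation. *)
Definition pmean c f : R := xget 0 [set s | balance c f s = 0].

Hypothesis r0 : 0 < r.

Lemma balance_increasing c f : is_weight c ->
  {homo balance c f : s s' / s < s'}.
Proof.
move=> [c0 [j cj]] s s' ss'; rewrite /balance.
rewrite (bigD1 j)//= [ltRHS](bigD1 j)//= ltr_leD//.
  by rewrite ltr_pM2l// ltr_spow// ltrD2r.
by apply: ler_sum => i _; rewrite ler_wpM2l// ler_spow// lerD2r ltW.
Qed.

Lemma ltr_balance c f : is_weight c -> {mono balance c f : s s' / s < s'}.
Proof. by move=> cw; exact/leW_mono/le_mono/balance_increasing. Qed.

Lemma balance_cvg c f (T : Type) (F : set_system T) (FF : Filter F)
    (f_ : I -> T -> R) (s_ : T -> R) s :
  (forall i, f_ i t @[t --> F] --> f i) -> s_ t @[t --> F] --> s ->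
  balance c (f_ ^~ t) (s_ t) @[t --> F] --> balance c f s.
Proof.
move=> hf hs; apply: cvg_sumr => i _; apply: cvgM; first exact: cvg_cst.
apply: continuous_cvg; first exact: spow_continuous.
by apply: cvgB.
Qed.

Lemma balance_root c f K : is_weight c -> (forall i, `|f i| <= K) ->
  exists2 s, `|s| <= K & balance c f s = 0.
Proof.
move=> [c0 [j cj]] fK.
have K0 : 0 <= K by apply: le_trans (fK j).
have lo : balance c f (- K) <= 0.
  apply: sumr_le0 => i _; rewrite mulr_ge0_le0// -(spow0 r) ler_spow// subr_le0.
  by have := fK i; rewrite ler_norml => /andP[].
have hi : 0 <= balance c f K.
  apply: sumr_ge0 => i _; rewrite mulr_ge0// -(spow0 r) ler_spow// subr_ge0.
  by have := fK i; rewrite ler_norml => /andP[].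
have [|||s sK s0] := @IVT R (balance c f) (- K) K 0.
- by rewrite ge0_cp.
- apply: continuous_subspaceT => s; apply: balance_cvg => // i; exact: cvg_cst.
- by rewrite ge_min lo/= le_max hi orbT.
by exists s => //; move: sK; rewrite in_itv/= -ler_norml.
Qed.

Lemma balance_pmean c f : is_weight c -> balance c f (pmean c f) = 0.
Proof.
move=> cw; rewrite /pmean; case: xgetP => [s -> //|no].
have fK i : `|f i| <= \sum_j `|f j|.
  by rewrite (bigD1 i)//= lerDl sumr_ge0.
have [s _ s0] := balance_root cw fK.
by case: (no s).
Qed.

Lemma pmean_eq c f s : is_weight c -> balance c f s = 0 -> pmean c f = s.
Proof.
move=> cw s0; have inj := inc_inj (le_mono (balance_increasing f cw)).
by apply: inj; rewrite balance_pmean.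
Qed.

Lemma pmean_gt c f s : is_weight c -> (s < pmean c f) = (balance c f s < 0).
Proof. by move=> cw; rewrite -(ltr_balance f cw) balance_pmean. Qed.

Lemma pmean_lt c f s : is_weight c -> (pmean c f < s) = (0 < balance c f s).
Proof. by move=> cw; rewrite -(ltr_balance f cw) balance_pmean. Qed.

Lemma norm_pmean_le c f K : is_weight c -> (forall i, `|f i| <= K) ->
  `|pmean c f| <= K.
Proof.
by move=> cw fK; have [s sK s0] := balance_root cw fK; rewrite (pmean_eq cw s0).
Qed.

(** For fixed [s] the sign of [balance c f s], which is continuous in [f],
    decides on which side of [s] the mean lies. *)
Lemma pmean_cvg c f (T : Type) (F : set_system T) (FF : Filter F)
    (f_ : I -> T -> R) : is_weight c ->
  (forall i, f_ i t @[t --> F] --> f i) ->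
  pmean c (f_ ^~ t) @[t --> F] --> pmean c f.
Proof.
move=> cw hf; apply/cvgrPdist_lt => e e0.
have bal s : balance c (f_ ^~ t) s @[t --> F] --> balance c f s.
  by apply: balance_cvg => //; exact: cvg_cst.
have lo : balance c f (pmean c f - e) < 0.
  by rewrite -pmean_gt// ltrBlDr ltrDl.
have hi : 0 < balance c f (pmean c f + e) by rewrite -pmean_lt// ltrDl.
near=> t; rewrite ltr_distlC; apply/andP; split.
  by rewrite pmean_gt//; near: t; exact: (cvgr_lt _ (bal _) _ lo).
by rewrite pmean_lt//; near: t; exact: (cvgr_gt _ (bal _) _ hi).
Unshelve. all: by end_near. Qed.
End PMean.

Section PMeanDerivable.
Variables (R : realType) (r : R) (I : finType) (c : I -> R) (f : I -> R -> R).
Variables (t : R) (a : I -> R).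
Hypotheses (r0 : 0 < r) (r1 : r < 1) (cw : is_weight c).

Let q i h : R := h^-1 * (f i (h + t) - f i t).

Hypothesis qa : forall i, q i h @[h --> 0^'] --> a i.

Let b s := pmean r c (f ^~ s).

Let shifted s h := balance r c (f ^~ (h + t)) (b t + h * s).

Let dnbhs_neq0 : \forall h \near (0 : R)^', h != 0.
Proof. exact: nbhs_dnbhs_neq. Qed.

(** A tangent-line test: when [balance], followed along lines of slope [s]
    through the mean at time [t], changes sign at time [t] according to the sign
    of [s - B], the mean is squeezed between the lines of slopes [B - e] and
    [B + e]. *)
Let derivable_of_sign (N L : R -> R) (B : R) :
  (forall h, h != 0 -> 0 < h * N h) ->
  {homo L : s s' / s < s'} -> L B = 0 ->
  (forall s, (N h)^-1 * shifted s h @[h --> 0^'] --> L s) ->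
  derivable b t 1.
Proof.
move=> Nsign Linc LB lim; apply/cvg_ex; exists B => /=.
apply/cvgrPdist_lt => e e0.
have lo : L (B - e) < 0 by rewrite -LB Linc// ltrBlDr ltrDl.
have hi : 0 < L (B + e) by rewrite -LB Linc// ltrDl.
near=> h.
have h0 : h != 0 by near: h; exact: dnbhs_neq0.
have blo : (N h)^-1 * shifted (B - e) h < 0.
  by near: h; exact: (cvgr_lt _ (lim _) _ lo).
have bhi : 0 < (N h)^-1 * shifted (B + e) h.
  by near: h; exact: (cvgr_gt _ (lim _) _ hi).
have hN := Nsign _ h0; rewrite /shifted in blo bhi.
rewrite ltr_distlC scaler1; change (h^-1 *: ?x) with (h^-1 * x).
have [hpos|hneg] := ltP 0 h.
  have N0 : 0 < (N h)^-1 by rewrite invr_gt0 -(pmulr_rgt0 _ hpos).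
  rewrite pmulr_rlt0// -pmean_gt// in blo.
  rewrite pmulr_rgt0// -pmean_lt// in bhi.
  rewrite mulrC ltr_pdivlMr// ltr_pdivrMr// ltrBrDl ltrBlDl.
  by rewrite ![_ * h]mulrC blo bhi.
have {}hneg : h < 0 by rewrite lt_neqAle h0.
have N0 : (N h)^-1 < 0 by rewrite invr_lt0 -(nmulr_rgt0 _ hneg).
rewrite nmulr_rlt0// -pmean_lt// in blo.
rewrite nmulr_rgt0// -pmean_gt// in bhi.
rewrite mulrC ltr_ndivlMr// ltr_ndivrMr// ltrBrDl ltrBlDl.
by rewrite ![_ * h]mulrC blo bhi.
Unshelve. all: by end_near. Qed.

Let incr i s h := spow r (b t + h * s - f i (h + t)) - spow r (b t - f i t).

Let shiftedE s h : shifted s h = \sum_i c i * incr i s h.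
Proof.
rewrite -[LHS]subr0 -[X in _ - X](@balance_pmean _ _ _ r0 c (f ^~ t))//.
by rewrite /shifted /balance -sumrB; apply: eq_bigr => i _; rewrite mulrBr.
Qed.

Let contact i := b t == f i t.

Let argE i s h : h != 0 ->
  b t + h * s - f i (h + t) = b t - f i t + h * (s - q i h).
Proof. by move=> h0; rewrite /q; field. Qed.

Let incr_contact i s : contact i ->
  (spow r h)^-1 * incr i s h @[h --> 0^'] --> spow r (s - a i).
Proof.
move=> /eqP ci.
apply: (@cvg_trans _ (spow r (s - q i h) @[h --> 0^'])).
  apply: near_eq_cvg; near=> h.
  have h0 : h != 0 by near: h; exact: dnbhs_neq0.
  have sh0 : spow r h != 0.
    by rewrite -(spow0 r) (inj_eq (inc_inj (ler_spow r0))).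
  by rewrite /incr argE// ci subrr add0r spow0 subr0 spowM mulKf.
apply: continuous_cvg; first exact: spow_continuous.
by apply: cvgB; [exact: cvg_cst|exact: qa].
Unshelve. all: by end_near. Qed.

Let slope i := r * `|b t - f i t| `^ (r - 1).

Let incr_apart i s : ~~ contact i ->
  h^-1 * incr i s h @[h --> 0^'] --> slope i * (s - a i).
Proof.
move=> ci; have d0 : b t - f i t != 0 by rewrite subr_eq0.
have [g [gE gc gd]] := (is_derive1_caratheodory _ _ _).1 (is_derive_spow r0 d0).
have h0l : h @[h --> (0 : R)^'] --> (0 : R) by exact: nbhs_dnbhs.
have sl : s - q i h @[h --> 0^'] --> s - a i.
  by apply: cvgB; [exact: cvg_cst|exact: qa].
apply: (@cvg_trans _
  (g (b t - f i t + h * (s - q i h)) * (s - q i h) @[h --> 0^'])).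
  apply: near_eq_cvg; near=> h.
  have h0 : h != 0 by near: h; exact: dnbhs_neq0.
  by rewrite /incr argE// gE; field.
apply: cvgM => //; rewrite /slope -gd; apply: continuous_cvg => //.
rewrite -[X in _ --> X]addr0; apply: cvgD; first exact: cvg_cst.
by rewrite -[X in _ --> X](mul0r (s - a i)); exact: cvgM.
Unshelve. all: by end_near. Qed.

Let ratio_cvg0 : (spow r h)^-1 * h @[h --> 0^'] --> 0.
Proof.
have lim : spow (1 - r) `|h| @[h --> (0 : R)^'] --> 0.
  rewrite -[X in _ --> X](spow0 (1 - r)).
  apply: continuous_cvg; first by apply: spow_continuous; rewrite subr_gt0.
  by rewrite -[X in _ --> X](normr0 R); apply: cvg_norm; exact: nbhs_dnbhs.
apply: cvg_trans lim; apply: near_eq_cvg; near=> h.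
have h0 : h != 0 by near: h; exact: dnbhs_neq0.
rewrite ger0_spow ?subr_gt0// /spow invfM -mulrA mulVf// mulr1.
by rewrite -powRN opprB.
Unshelve. all: by end_near. Qed.

Let incr_apart0 i s : ~~ contact i ->
  (spow r h)^-1 * incr i s h @[h --> 0^'] --> 0.
Proof.
move=> ci.
have lim : (spow r h)^-1 * h * (h^-1 * incr i s h) @[h --> 0^'] --> 0.
  rewrite -[X in _ --> X](mul0r (slope i * (s - a i))).
  exact: (cvgM ratio_cvg0 (@incr_apart i s ci)).
apply: cvg_trans lim.
apply: near_eq_cvg; near=> h.
have h0 : h != 0 by near: h; exact: dnbhs_neq0.
by rewrite -mulrA mulVKf.
Unshelve. all: by end_near. Qed.

(** [spow r] is steeper than linear at [0].  Hence, when some value in contact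
    with the mean carries weight, the values in contact alone decide, and the
    derivative of the mean is the p-mean of their derivatives. Otherwise the
    implicit function theorem applies, and the derivative is a weighted
    arithmetic mean. *)
Lemma pmean_derivable_cvg : derivable b t 1.
Proof.
have [[j /andP[jc cj]]|no] := pselect (exists j, contact j && (0 < c j)).
  pose c' i := if contact i then c i else 0.
  have c'w : is_weight c'.
    split; last by exists j; rewrite /c' jc.
    by move=> i; rewrite /c'; case: ifP => // _; exact: cw.1.
  apply: (@derivable_of_sign (spow r) (balance r c' a) (pmean r c' a)).
  - by move=> h h0; rewrite mulrC spow_mul_self// powR_gt0// normr_gt0.
  - exact: balance_increasing.
  - exact: balance_pmean.
  move=> s; under eq_fun do rewrite shiftedE mulr_sumr.
  apply: cvg_sumr => i _; under eq_fun do rewrite mulrCA.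
  rewrite /c'; case: ifPn => ci.
    by apply: cvgM; [exact: cvg_cst|exact: incr_contact].
  rewrite mul0r.
  have lim : c i * ((spow r h)^-1 * incr i s h) @[h --> 0^'] --> c i * 0.
    by apply: cvgM; [exact: cvg_cst|exact: incr_apart0].
  by rewrite mulr0 in lim.
have c0 i : contact i -> c i = 0.
  move=> ci; apply/eqP; rewrite eq_le cw.1 andbT leNgt; apply/negP => ci0.
  by apply: no; exists i; rewrite ci.
have sl0 i : ~~ contact i -> 0 < slope i.
  by move=> ci; rewrite mulr_gt0// powR_gt0// normr_gt0 subr_eq0.
pose w i := c i * slope i.
have w0 i : 0 <= w i.
  case: (boolP (contact i)) => ci; first by rewrite /w c0// mul0r.
  by rewrite mulr_ge0 ?cw.1// ltW// sl0.
have W0 : 0 < \sum_i w i.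
  have [j cj] := cw.2.
  have jc : ~~ contact j by apply/negP => /c0 e; rewrite e ltxx in cj.
  rewrite (bigD1 j)//= ltr_wpDr ?sumr_ge0//.
  by rewrite mulr_gt0// sl0.
pose B := (\sum_i w i * a i) / (\sum_i w i).
have LE s : \sum_i w i * (s - a i) = (\sum_i w i) * (s - B).
  rewrite mulrBr mulrCA divff ?gt_eqF// mulr1 mulr_suml -sumrB.
  by apply: eq_bigr => i _; rewrite mulrBr.
apply: (@derivable_of_sign id (fun s => \sum_i w i * (s - a i)) B).
- by move=> h h0 /=; rewrite -expr2 exprn_even_gt0.
- by move=> s s' ss'; rewrite !LE ltr_pM2l// ltrD2r.
- by rewrite LE subrr mulr0.
move=> s; under eq_fun do rewrite shiftedE mulr_sumr.
apply: cvg_sumr => i _; under eq_fun do rewrite mulrCA.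
rewrite /w -mulrA; case: (boolP (contact i)) => ci.
  by rewrite c0// mul0r; under eq_fun do rewrite mul0r; exact: cvg_cst.
by apply: cvgM; [exact: cvg_cst|exact: incr_apart].
Unshelve. all: by end_near. Qed.

End PMeanDerivable.

Lemma pmean_derivable (R : realType) (r : R) (I : finType) (c : I -> R)
    (f : I -> R -> R) (t : R) : 0 < r -> r < 1 -> is_weight c ->
  (forall i, derivable (f i) t 1) ->
  derivable (fun s => pmean r c (f ^~ s)) t 1.
Proof.
move=> r0 r1 cw df.
apply: (@pmean_derivable_cvg _ _ _ _ _ _ (fun i => 'D_1 (f i) t)) => // i.
have := df i; rewrite /derivable /derive.
set F := fun h => _; rewrite (_ : (fun h => _) = F) //.
by apply/funext => h; rewrite /F /= [h *: 1]mulr1.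
Qed.

(** * Existence of solutions for continuous vector fields *)

(** Limits along an ultrafilter replace the extraction of subsequences: one
    ultrafilter serves all times and coordinates at once. *)
Lemma bounded_ultra_cvg (R : realType) (T : Type) (U : set_system T)
    (UU : UltraFilter U) (u : T -> R) (K : R) :
  (forall n, `|u n| <= K) -> cvg (u @ U).
Proof.
move=> uK.
have [p [_ clp]] : `[- K, K] `&` cluster (u @ U) !=set0.
  apply: segment_compact; apply: (@filterS _ U _ setT _ _ filterT) => n _ /=.
  by rewrite in_itv/= -ler_norml.
apply/cvg_ex; exists p => B Bp /=.
have [//|UC] := in_ultra_setVsetC (u @^-1` B) UU.
by have [y [yC /yC]] := clp (~` B) B UC Bp.
Qed.

Section Euler.
Variables (R : realType) (I : finType) (F : (I -> R) -> I -> R) (x0 : I -> R).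

Definition euler (h : R) k : I -> R := iter k (fun v i => v i + h * F v i) x0.

Lemma euler_increment h k m i d e : 0 <= h ->
  (forall j, (k <= j < k + m)%N -> `|F (euler h j) i - d| <= e) ->
  `|euler h (k + m) i - euler h k i - m%:R * h * d| <= m%:R * h * e.
Proof.
move=> h0; elim: m => [|m IH] Fe.
  by rewrite addn0 subrr !mul0r subr0 normr0.
have {}IH : `|euler h (k + m) i - euler h k i - m%:R * h * d| <= m%:R * h * e.
  by apply: IH => j /andP[kj jm]; apply: Fe; rewrite kj addnS ltnS ltnW.
rewrite addnS /= -/(euler h (k + m)).
have -> : euler h (k + m) i + h * F (euler h (k + m)) i - euler h k i
    - m.+1%:R * h * d
  = (euler h (k + m) i - euler h k i - m%:R * h * d)
    + h * (F (euler h (k + m)) i - d) by rewrite -natr1; ring.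
rewrite -natr1 mulrDl mul1r mulrDl (le_trans (ler_normD _ _))// lerD//.
rewrite normrM ger0_norm// ler_wpM2l// Fe//.
by rewrite leq_addr addnS ltnSn.
Qed.

Lemma euler_lipschitz h k l i M : 0 <= h -> (forall v, `|F v i| <= M) ->
  (k <= l)%N -> `|euler h l i - euler h k i| <= (l - k)%:R * h * M.
Proof.
move=> h0 FM kl; have := @euler_increment h k (l - k) i 0 M h0.
by rewrite subnKC// mulr0 subr0; apply => j _; rewrite subr0.
Qed.

End Euler.

(** An integral curve for nonnegative times.  The derivative is expressed by a
    first-order expansion, which at time [0] only looks to the right. *)
Definition forward_solution (R : realType) (I : finType)
    (F : (I -> R) -> I -> R) (x : R -> I -> R) : Prop :=
  forall t i e, 0 <= t -> 0 < e -> exists2 d, 0 < d &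
    forall s, 0 <= s -> `|s - t| < d ->
      `|x s i - x t i - (s - t) * F (x t) i| <= e * `|s - t|.

Definition field_continuous (R : realType) (I : finType)
    (F : (I -> R) -> I -> R) : Prop :=
  forall v e, 0 < e -> exists2 d, 0 < d &
    forall w, (forall i, `|w i - v i| < d) -> forall i, `|F w i - F v i| <= e.

Section Peano.
Variables (R : realType) (I : finType) (F : (I -> R) -> I -> R) (x0 : I -> R).
Variable M : R.
Hypotheses (FM : forall v i, `|F v i| <= M) (Fc : field_continuous F).

Let h n : R := n.+1%:R^-1.
Let idx n (t : R) := Num.truncn (t * n.+1%:R).
Let X n t := euler F x0 (h n) (idx n t).

Let h_gt0 n : 0 < h n. Proof. by rewrite invr_gt0 ltr0n. Qed.

Let idx_le n s t : s <= t -> (idx n s <= idx n t)%N.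
Proof. by move=> st; apply: Num.Theory.le_truncn; rewrite ler_wpM2r. Qed.

Let idx_near n t : 0 <= t -> t - h n < (idx n t)%:R * h n <= t.
Proof.
move=> t0; have tn0 : 0 <= t * n.+1%:R by rewrite mulr_ge0.
have /andP[lo hi] := truncn_itv tn0.
have n0 : 0 < n.+1%:R :> R by rewrite ltr0n.
rewrite /h ler_pdivrMr// lo andbT ltr_pdivlMr// mulrBl mulVf ?gt_eqF//.
by rewrite ltrBlDr natr1.
Qed.

Let gap n s t : s <= t -> (idx n t - idx n s)%:R * h n
  = (idx n t)%:R * h n - (idx n s)%:R * h n.
Proof. by move=> st; rewrite natrB ?idx_le// mulrBl. Qed.

Let M0 (i : I) : 0 <= M.
Proof. exact: le_trans (normr_ge0 _) (FM x0 i). Qed.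

Let X_lipschitz n s t i : 0 <= s -> s <= t ->
  `|X n t i - X n s i| <= (t - s + h n) * M.
Proof.
move=> s0 st; apply: le_trans (euler_lipschitz x0 (ltW (h_gt0 n))
  (fun v => FM v i) (idx_le n st)) _.
rewrite ler_wpM2r ?(M0 i)// gap//.
have /andP[+ _] := idx_near n s0.
have /andP[_ +] := idx_near n (le_trans s0 st).
by lra.
Qed.

(** The terms in [h n] account for the rounding of times down to the grid. *)
Let X_expansion n t a b v i e d : 0 <= a -> a <= b -> t = a \/ t = b ->
  (forall w, (forall j, `|w j - v j| < d) -> `|F w i - F v i| <= e) ->
  (forall j, `|X n t j - v j| < d / 2) -> (b - a + h n) * M < d / 2 ->
  `|X n b i - X n a i - (b - a) * F v i| - h n * (`|F v i| + e)
    <= (b - a) * e.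
Proof.
move=> a0 ab tab Fv Xv small; have hn := ltW (h_gt0 n).
have kl := idx_le n ab; have b0 := le_trans a0 ab.
have [/andP[aL aU] /andP[bL bU]] := (idx_near n a0, idx_near n b0).
have t0 : 0 <= t by case: tab => ->.
have steps : (idx n b - idx n a)%:R * h n <= b - a + h n.
  by rewrite gap//; lra.
have tE : idx n t = idx n a \/ idx n t = idx n b.
  by case: tab => ->; [left|right].
have close j : (idx n a <= j <= idx n b)%N ->
    `|F (euler F x0 (h n) j) i - F v i| <= e.
  move=> /andP[aj jb]; apply: Fv => m.
  have : `|euler F x0 (h n) j m - X n t m| < d / 2.
    apply: le_lt_trans small.
    apply: (@le_trans _ _ ((idx n b - idx n a)%:R * h n * M)); last first.
      by rewrite ler_wpM2r ?(M0 i).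
    rewrite /X; case: tE => ->; last rewrite distrC;
      apply: (le_trans (euler_lipschitz x0 hn (fun v => FM v m) _)) => //;
      by rewrite !ler_wpM2r ?(M0 i)// ler_nat; rewrite ?leq_sub2r ?leq_sub2l.
  move=> Ej; rewrite [d]splitr.
  by rewrite (le_lt_trans (ler_distD (X n t m) _ _))// ltrD.
have := @euler_increment _ _ F x0 (h n) (idx n a) (idx n b - idx n a) i
  (F v i) e hn.
rewrite subnKC// => /(_ _)/wrap[j /andP[aj jb]|].
  by apply: close; rewrite aj ltnW.
rewrite gap// -/(X n b) -/(X n a) => main.
have e0 : 0 <= e.
  by have := close (idx n a); rewrite leqnn kl => /(_ isT); apply: le_trans.
set g := (idx n b)%:R * h n - (idx n a)%:R * h n in main.
have gab : `|g - (b - a)| <= h n.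
  by rewrite /g ler_norml; apply/andP; split; lra.
have split_err : `|X n b i - X n a i - (b - a) * F v i|
    <= `|X n b i - X n a i - g * F v i| + h n * `|F v i|.
  have -> : X n b i - X n a i - (b - a) * F v i
    = X n b i - X n a i - g * F v i + (g - (b - a)) * F v i by ring.
  by rewrite (le_trans (ler_normD _ _))// lerD2l normrM ler_wpM2r.
have ge : g * e <= (b - a + h n) * e.
  by rewrite ler_wpM2r//; move: gab; rewrite ler_norml => /andP[]; lra.
lra.
Qed.

(** Peano's theorem.  The Euler schemes are uniformly Lipschitz, so that near a
    time [t] they stay close to their limit at [t]; by continuity of [F] they then
    move with almost constant velocity, and this passes to the limit directly,
    without integrating the equation. *)
Lemma peano : exists x, [/\ x 0 = x0, forward_solution F x
  & forall t i, 0 <= t -> `|x t i - x0 i| <= t * M].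
Proof.
have [U [UU Uoo]] := @ultraFilterLemma nat \oo _.
have X0 n : X n 0 = x0 by rewrite /X /idx mul0r truncn0.
have h0 : h n @[n --> U] --> 0.
  by move=> B /(@cvg_harmonic R) hB; exact: Uoo.
have hsmall d : 0 < d -> \forall n \near U, h n < d.
  by move=> d0; exact: (cvgr_lt _ h0 _ d0).
have Xb n t i : 0 <= t -> `|X n t i - x0 i| <= (t + h n) * M.
  by move=> t0; have := X_lipschitz n i (lexx 0) t0; rewrite X0 subr0.
have Xc t i : 0 <= t -> cvg (X n t i @[n --> U]).
  move=> t0; apply: (@bounded_ultra_cvg _ _ _ _ _ (`|x0 i| + (t + 1) * M)) => n.
  rewrite -[X in `|X|](subrK (x0 i)) addrC.
  rewrite (le_trans (ler_normD _ _))// lerD2l (le_trans (Xb n t i t0))//.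
  by rewrite ler_wpM2r ?(M0 i)// lerD2l invf_le1 ?ler1n ?ltr0n.
pose x t i := lim (X n t i @[n --> U]).
exists x; split.
- apply/funext => i; apply: cvg_lim => //.
  rewrite (_ : (fun n => X n 0 i) = fun=> x0 i); first exact: cvg_cst.
  by apply/funext => n; rewrite X0.
- move=> t i e t0 e0; have [d d0 Fd] := Fc (x t) e0.
  have M1 : 0 < M + 1 by rewrite ltr_wpDl// (M0 i).
  have r0 : 0 < d / 4 / (M + 1) by rewrite !divr_gt0.
  have Xt : \forall n \near U, forall j, `|X n t j - x t j| < d / 2.
    apply: filter_forall => j; under eq_near do rewrite distrC.
    by apply: (cvgr_dist_lt _ _ (Xc t j t0)); rewrite divr_gt0.
  (* The bound is symmetric in the two times, so they are sorted first. *)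
  have expansion a b : 0 <= a -> a <= b -> t = a \/ t = b ->
      b - a < d / 4 / (M + 1) ->
      `|x b i - x a i - (b - a) * F (x t) i| <= (b - a) * e.
    move=> a0 ab tab bar; have b0 := le_trans a0 ab.
    have lim : `|X n b i - X n a i - (b - a) * F (x t) i|
        - h n * (`|F (x t) i| + e) @[n --> U]
        --> `|x b i - x a i - (b - a) * F (x t) i| - 0 * (`|F (x t) i| + e).
      apply: cvgB; last by apply: cvgM => //; exact: cvg_cst.
      apply: cvg_norm; apply: cvgB; last exact: cvg_cst.
      by apply: cvgB; exact: Xc.
    rewrite mul0r subr0 in lim; apply: (cvgr_to_le lim).
    near=> n; apply: (@X_expansion n t a b (x t) i e d) => //.
    - by move=> w wd; exact: Fd.
    - by near: n; exact: Xt.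
    have hn : h n < d / 4 / (M + 1) by near: n; exact: hsmall.
    have le1 : (b - a + h n) * M <= (b - a + h n) * (M + 1).
      by rewrite ler_wpM2l// ?lerDl// addr_ge0 ?subr_ge0// ltW// h_gt0.
    apply: le_lt_trans le1 _; rewrite -ltr_pdivlMr//.
    have -> : d / 2 / (M + 1) = d / 4 / (M + 1) + d / 4 / (M + 1).
      by rewrite -mulrDl; congr (_ / _); lra.
    exact: ltrD.
  exists (d / 4 / (M + 1)) => // s s0; have [ts|st] := leP t s => std.
    rewrite [`|s - t|]ger0_norm ?subr_ge0// in std *.
    by rewrite [e * _]mulrC; apply: expansion => //; left.
  have ts0 : 0 <= t - s by rewrite subr_ge0 ltW.
  rewrite distrC ger0_norm// in std.
  rewrite [`|s - t|]distrC [`|t - s|]ger0_norm//.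
  rewrite -normrN [e * _]mulrC.
  have -> : - (x s i - x t i - (s - t) * F (x t) i)
    = x t i - x s i - (t - s) * F (x t) i by ring.
  by apply: expansion => //; [exact: ltW|right].
- move=> t i t0.
  have lim : `|X n t i - x0 i| - h n * M @[n --> U]
      --> `|x t i - x0 i| - 0 * M.
    apply: cvgB; last by apply: cvgM => //; exact: cvg_cst.
    by apply: cvg_norm; apply: cvgB; [exact: Xc|exact: cvg_cst].
  rewrite mul0r subr0 in lim; apply: (cvgr_to_le lim).
  by near=> n; rewrite lerBlDr -mulrDl Xb.
Unshelve. all: by end_near. Qed.

End Peano.

(** * The network problem as an ordinary differential equation *)

Section NetworkField.
Variables (R : realType) (V : finType) (G : network R V) (S : {set V}).
Variables (mu sigma : V -> R) (p lambda : R).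
Hypotheses (hcoef : boundary_coefficients G S mu sigma).
Hypotheses (hp : 0 < p - 1) (hlambda : 0 < lambda).
Implicit Types (u v : V -> R) (x y z : V).

Lemma cweight_ge0 x y : 0 <= cweight G S x y.
Proof. by rewrite /cweight; case: ifP => // _; exact: weight_ge0. Qed.

Lemma cweight_sym x y : cweight G S x y = cweight G S y x.
Proof. by rewrite /cweight orbC weight_sym. Qed.

Lemma mem_nclosure x :
  (x \in nclosure G S) = (x \in S) || (x \in nboundary G S).
Proof. by rewrite /nclosure finset.in_setU. Qed.

Lemma sub_nclosure x : x \in S -> x \in nclosure G S.
Proof. by rewrite mem_nclosure => ->. Qed.

Lemma nboundary_notin z : z \in nboundary G S -> z \notin S.
Proof. by rewrite finset.inE => /andP[]. Qed.

Lemma spow_p_sub2 a : `|a| `^ (p - 2) * a = spow (p - 1) a.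
Proof. by rewrite /spow; congr (powR _ _ * _); ring. Qed.

Lemma plaplacianE u x : plaplacian G S p u x =
  - \sum_(y in nclosure G S) spow (p - 1) (u x - u y) * cweight G S x y.
Proof.
rewrite -sumrN; apply: eq_bigr => y _.
by rewrite -spow_p_sub2 -[u y - u x]opprB mulrN mulNr.
Qed.

Lemma pnormal_derivativeE u z : pnormal_derivative G S p u z =
  \sum_(y in S) spow (p - 1) (u z - u y) * cweight G S z y.
Proof. by apply: eq_bigr => y _; rewrite spow_p_sub2. Qed.

Lemma eq_plaplacian u v x : {in nclosure G S, u =1 v} -> x \in S ->
  plaplacian G S p u x = plaplacian G S p v x.
Proof.
move=> uv xS; rewrite !plaplacianE; congr (- _); apply: eq_bigr => y yS.
by rewrite !uv// sub_nclosure.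
Qed.

(** The boundary condition at [z] is a balance between the neighbours of [z] in
    [S] and one more vertex, [None], that carries the value [0] and the weight
    [sigma z]; so boundary values are p-means. *)
Definition bweight z (o : option V) : R :=
  if o is Some y then (if y \in S then mu z * cweight G S z y else 0)
  else sigma z.

Definition bvalue v (o : option V) : R :=
  if o is Some y then (if y \in S then v y else 0) else 0.

Lemma bweight_is_weight z : z \in nboundary G S -> is_weight (bweight z).
Proof.
move=> zB; have [mu0 sigma0 pos] := hcoef zB; split=> [[y|]|] //=.
  by case: ifP => // _; rewrite mulr_ge0// cweight_ge0.
have [mupos|mupos] := ltP 0 (mu z); last first.
  exists None => /=; move: pos; rewrite (_ : mu z = 0) ?add0r//.
  exact/le_anti/andP.
move: zB; rewrite finset.inE => /andP[zS /exists_inP[y yS yz]].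
exists (Some y); rewrite /= yS mulr_gt0// /cweight yS orbT.
by rewrite weight_gt0 adj_sym.
Qed.

Lemma balance_bvalue u z : z \in nboundary G S ->
  balance (p - 1) (bweight z) (bvalue u) (u z)
  = mu z * pnormal_derivative G S p u z
    + sigma z * (`|u z| `^ (p - 2) * u z).
Proof.
move=> zB; rewrite /balance (bigD1 None)//= subr0 addrC spow_p_sub2.
congr (_ + _).
rewrite pnormal_derivativeE mulr_sumr.
rewrite (reindex_omap Some id) /=; last by case.
rewrite [RHS]big_mkcond /=; apply: eq_big => [y|y _]; first by rewrite eqxx.
by case: ifP => yS; rewrite ?mul0r// -mulrA; congr (_ * _); rewrite mulrC.
Qed.

Definition fill v x : R :=
  if x \in S then v x else pmean (p - 1) (bweight x) (bvalue v).

Lemma bvalue_fill v : bvalue (fill v) = bvalue v.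
Proof. by apply/funext; case=> [y|] //=; rewrite /fill; case: (y \in S). Qed.

Lemma fill_boundary v z : z \in nboundary G S ->
  mu z * pnormal_derivative G S p (fill v) z
    + sigma z * (`|fill v z| `^ (p - 2) * fill v z) = 0.
Proof.
move=> zB; rewrite -balance_bvalue// bvalue_fill /fill.
rewrite (negbTE (nboundary_notin zB)).
by rewrite balance_pmean//; exact: bweight_is_weight.
Qed.

Lemma fill_eq u :
  (forall z, z \in nboundary G S -> mu z * pnormal_derivative G S p u z
    + sigma z * (`|u z| `^ (p - 2) * u z) = 0) ->
  {in nclosure G S, fill u =1 u}.
Proof.
move=> bc x; rewrite mem_nclosure /fill; case: ifP => //= xS xB.
by apply: pmean_eq => //; [exact: bweight_is_weight|rewrite balance_bvalue ?bc].
Qed.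

(** The right-hand side of the equation after the boundary values have been
    eliminated. *)
Definition field v x : R :=
  if x \in S then plaplacian G S p (fill v) x + lambda * spow (p - 1) (v x)
  else 0.

Lemma fill_cvg (T : Type) (F : set_system T) (FF : Filter F)
    (v_ : T -> V -> R) v :
  (forall y, y \in S -> v_ t y @[t --> F] --> v y) ->
  forall x, x \in nclosure G S -> fill (v_ t) x @[t --> F] --> fill v x.
Proof.
move=> hv x; rewrite mem_nclosure /fill.
have [xS _|xS /= xB] := boolP (x \in S); first exact: hv.
apply: (@pmean_cvg _ _ _ hp _ _ _ _ _ (fun o t => bvalue (v_ t) o)).
  exact: bweight_is_weight.
case=> [y|] /=; last exact: cvg_cst.
by case: ifP => yS; [exact: hv|exact: cvg_cst].
Qed.

Lemma field_cvg (T : Type) (F : set_system T) (FF : Filter F)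
    (v_ : T -> V -> R) v :
  (forall y, y \in S -> v_ t y @[t --> F] --> v y) ->
  forall x, field (v_ t) x @[t --> F] --> field v x.
Proof.
move=> hv x; rewrite /field.
have [xS|xS] := boolP (x \in S); last exact: cvg_cst.
have sp := spow_continuous hp.
apply: cvgD; last first.
  by apply: cvgM; [exact: cvg_cst|apply: continuous_cvg; [exact: sp|exact: hv]].
rewrite plaplacianE; under eq_fun do rewrite plaplacianE.
apply: cvgN; apply: cvg_sumr => y yS; apply: cvgM; last exact: cvg_cst.
apply: continuous_cvg; first exact: sp.
apply: cvgB; apply: fill_cvg => //.
exact: sub_nclosure.
Qed.

Lemma fill_bound v K x : 0 <= K -> (forall y, y \in S -> `|v y| <= K) ->
  x \in nclosure G S -> `|fill v x| <= K.
Proof.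
move=> K0 vK; rewrite mem_nclosure /fill.
case: ifP => [xS _|_ /= xB]; first exact: vK.
apply: norm_pmean_le => //; first exact: bweight_is_weight.
by case=> [y|] /=; [case: ifP => // yS; [exact: vK|]|]; rewrite normr0.
Qed.

Lemma field_bound K : 0 <= K -> exists2 M, 0 <= M &
  forall v, (forall y, y \in S -> `|v y| <= K) -> forall x, `|field v x| <= M.
Proof.
move=> K0; have sp0 a : 0 <= a -> 0 <= spow (p - 1) a.
  by move=> a0; rewrite ger0_spow// powR_ge0.
pose m x := \sum_(y in nclosure G S) spow (p - 1) (K + K) * cweight G S x y.
have m0 x : 0 <= m x.
  by apply: sumr_ge0 => y _; rewrite mulr_ge0 ?sp0 ?cweight_ge0// addr_ge0.
have c0 : 0 <= lambda * spow (p - 1) K by rewrite mulr_ge0 ?sp0// ltW.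
exists (\sum_x m x + lambda * spow (p - 1) K).
  by rewrite addr_ge0 ?sumr_ge0.
move=> v vK x; rewrite /field; case: ifP => xS; last first.
  by rewrite normr0 addr_ge0 ?sumr_ge0.
rewrite (le_trans (ler_normD _ _))// lerD//; last first.
  by rewrite normrM gtr0_norm// ler_pM2l// norm_spow ler_spow// vK.
rewrite (bigD1 x)//= ler_wpDr ?sumr_ge0//.
rewrite plaplacianE normrN (le_trans (ler_norm_sum _ _ _))//.
apply: ler_sum => y yS; rewrite normrM (ger0_norm (cweight_ge0 _ _)).
rewrite ler_wpM2r ?cweight_ge0// norm_spow ler_spow//.
by rewrite (le_trans (ler_normB _ _))// lerD// fill_bound// sub_nclosure.
Qed.

(** Truncation makes the field bounded; it changes nothing as long as the
    solution stays within the truncation level. *)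
Definition clamp K v x : R := Num.max (- K) (Num.min K (v x)).

Lemma norm_clamp_le K v x : 0 <= K -> `|clamp K v x| <= K.
Proof.
move=> K0; rewrite ler_norml /clamp le_max lexx/= ge_max ge_min lexx/= andbT.
by rewrite ge0_cp.
Qed.

Lemma clamp_id K v x : `|v x| <= K -> clamp K v x = v x.
Proof.
rewrite ler_norml /clamp => /andP[lo hi].
by rewrite (min_idPr hi) (max_idPr lo).
Qed.

Lemma eq_field u v : {in S, u =1 v} -> field u = field v.
Proof.
move=> uv; apply/funext => x; rewrite /field; case: ifP => // xS.
rewrite uv// (_ : fill u = fill v)//; apply/funext => y; rewrite /fill.
case: ifP => [yS|_]; first exact: uv.
congr pmean; apply/funext; case=> [w|] //=; case: ifP => // wS; exact: uv.
Qed.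

Lemma field_clamp_continuous K : field_continuous (field \o clamp K).
Proof.
move=> v e e0.
(* The filter of uniform neighbourhoods of [v] turns limits into moduli. *)
pose B := [set d : R | 0 < d].
pose near_v d := [set w : V -> R | forall i, `|w i - v i| < d].
have FF : Filter (filter_from B near_v).
  apply: filter_from_filter; first by exists 1; rewrite /B /=.
  move=> d d' d0 d0'; exists (Num.min d d'); first by rewrite /B /= lt_min d0.
  by move=> w wv; split=> i; have := wv i; rewrite lt_min => /andP[].
have id_cvg y : w y @[w --> filter_from B near_v] --> v y.
  apply/cvgrPdist_lt => d d0; exists d => // w /= /(_ y).
  by rewrite distrC.
have cc : continuous (fun a : R => Num.max (- K) (Num.min K a)).
  move=> a; apply: (@continuous_max _ R^o (cst (- K)) (cst K \min id)).
    exact: cvg_cst.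
  by apply: continuous_min; [exact: cvg_cst|exact: cvg_id].
have F_cvg x : field (clamp K w) x @[w --> filter_from B near_v]
    --> field (clamp K v) x.
  by apply: field_cvg => y _; exact: (cvg_comp _ _ (id_cvg y) (cc (v y))).
have F_near x : \forall w \near filter_from B near_v,
    `|field (clamp K w) x - field (clamp K v) x| <= e.
  exact: (cvgr_distC_le _ _ (F_cvg x)).
have [d d0 dP] := filter_forall _ F_near.
by exists d => // w wv x; exact: dP.
Qed.

Section Solution.
Variables (u0 : V -> R) (T : \bar R) (u : V -> R -> R).
Hypothesis hu : solves_on G S mu sigma p (p - 1) lambda u0 T u.

Lemma solution_fill t : time_interval T t ->
  {in nclosure G S, fill (u ^~ t) =1 u ^~ t}.
Proof. by case: hu => _ _ bc _ tT; apply: fill_eq => z zB; exact: bc. Qed.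

Lemma field_solution x t : x \in S -> time_interval T t ->
  field (u ^~ t) x
  = plaplacian G S p (u ^~ t) x + lambda * spow (p - 1) (u x t).
Proof.
move=> xS tT; rewrite /field xS; congr (_ + _); apply: eq_plaplacian => // y.
exact: solution_fill.
Qed.

Lemma solution_is_derive x t : x \in S -> 0 < t -> (t%:E < T)%E ->
  is_derive t 1 (u x) (field (u ^~ t) x).
Proof.
move=> xS t0 tT; have [reg ode _ _] := hu.
have [_ dx] := reg _ (sub_nclosure xS).
apply: DeriveDef; first exact: dx.
by rewrite -derive1E ode// field_solution//; split => //; exact: ltW.
Qed.

End Solution.

End NetworkField.

(** * Continuation of bounded solutions *)

Lemma is_derive_expansion (R : realType) (g : R -> R) (t D : R) :
  (forall e, 0 < e -> exists2 d, 0 < d & forall s, `|s - t| < d ->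
     `|g s - g t - (s - t) * D| <= e * `|s - t|) ->
  is_derive t 1 g D.
Proof.
move=> gD.
have lim : h^-1 *: (g (h *: 1 + t) - g t) @[h --> 0^'] --> D.
  apply/cvgrPdist_le => e e0; have [d d0 dP] := gD e e0; near=> h.
  have h0 : h != 0 by near: h; exact: nbhs_dnbhs_neq.
  have hd : `|h| < d by near: h; exact: dnbhs0_lt.
  have -> : h *: 1 = h :> R by rewrite [LHS]mulr1.
  have := dP (h + t); rewrite addrK => /(_ hd) bound.
  have hpos : 0 < `|h| by rewrite normr_gt0.
  rewrite -(ler_pM2l hpos) -normrM mulrC [leRHS]mulrC.
  rewrite (_ : _ * h = - (g (h + t) - g t - h * D)) ?normrN//.
  by change (h^-1 *: ?x) with (h^-1 * x); field.
by apply: DeriveDef; [apply/cvg_ex; exists D|apply: cvg_lim].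
Unshelve. all: by end_near. Qed.

Lemma near_leftP (R : realType) (T : R) (P : set R) :
  (\forall c \near T^'-, P c) ->
  exists2 d, 0 < d & forall c, T - d < c -> c < T -> P c.
Proof.
case=> d /= d0 dP; exists d => // c cd cT; apply: dP => //=.
by rewrite gtr0_norm ?subr_gt0// ltrBlDr -ltrBlDl.
Qed.

(** Adding the linear function [M t] makes [f] monotone. *)
Lemma left_limit (R : realType) (f df : R -> R) (a b K M : R) :
  a < b -> (forall t, a < t -> t < b -> is_derive t 1 f (df t)) ->
  (forall t, a < t -> t < b -> `|f t| <= K) ->
  (forall t, a < t -> t < b -> `|df t| <= M) ->
  cvg (f t @[t --> b^'-]).
Proof.
move=> ab fdf fK dfM; pose g t := f t + M * t.
have M0 : 0 <= M.
  have /andP[am mb] : a < (a + b) / 2 < b by rewrite !midf_lt.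
  exact: le_trans (dfM _ am mb).
have gd t : a < t -> t < b -> is_derive t 1 g (df t + M).
  move=> at_ tb; have := fdf t at_ tb => fd; rewrite /g.
  have -> : (fun s => f s + M * s) = f + M *: id by [].
  by apply: is_derive_eq; rewrite [M *: _]mulr1.
have g_nd c : a < c -> {in `]c, b[ &, {homo g : x y / x <= y}}.
  move=> ac; apply: ger0_derive1_le_oo => x.
  - rewrite in_itv/= => /andP[cx xb].
    by have [] := gd x (lt_trans ac cx) xb.
  - rewrite in_itv/= => /andP[cx xb]; have ax := lt_trans ac cx.
    have gdx := gd x ax xb.
    rewrite derive1E derive_val -lerBlDr sub0r.
    by have := dfM x ax xb; rewrite ler_norml => /andP[].
  rewrite inE/= in_itv/= => /andP[cx xb].
  by apply/differentiable_continuous/derivable1_diffP;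
    have [] := gd x (lt_trans ac cx) xb.
have gcvg : cvg (g t @[t --> b^'-]).
  apply: nondecreasing_at_left_is_cvgr; near=> c.
    by apply: g_nd; near: c; exact: nbhs_left_gt.
  have ac : a < c by near: c; exact: nbhs_left_gt.
  exists (K + M * b) => _ [y + <-]; rewrite /= in_itv/= => /andP[cy yb].
  rewrite lerD ?ler_wpM2l ?(ltW yb)//.
  by apply: le_trans (fK y _ yb); [exact: ler_norm|exact: lt_trans cy].
have -> : f = (fun t => g t - M * t) by apply/funext => t; rewrite /g addrK.
apply: is_cvgB => //; apply/cvg_ex; exists (M * b).
by apply: cvgM; [exact: cvg_cst|exact: cvg_at_left_filter].
Unshelve. all: by end_near. Qed.

Lemma continuous_time_interval (R : realType) (f g : R -> R) (T T' : R) :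
  0 < T -> {within time_interval T%:E, continuous f} ->
  (forall t, 0 <= t -> t < T -> g t = f t) ->
  (forall t, 0 < t -> t < T' -> derivable g t 1) ->
  {within time_interval T'%:E, continuous g}.
Proof.
move=> T0 /subspace_continuousP cf gf dg; apply/subspace_continuousP => t [t0].
rewrite lte_fin => tT'; move: t0; rewrite le_eqVlt => /predU1P[<-|t0]; last first.
  apply: cvg_within_filter.
  by apply/differentiable_continuous/derivable1_diffP; exact: dg.
have f0 := cf 0 (conj (lexx 0) T0).
have g0 : g 0 = f 0 by rewrite gf.
rewrite /from_subspace g0 => B /f0 fB.
have {}fB : \forall s \near (0 : R), time_interval T%:E s -> B (f s) := fB.
suff : \forall s \near (0 : R), time_interval T'%:E s -> B (g s) by [].
apply: filterS2 fB (lt_nbhsl T0) => s fBs sT [s0 _].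
by rewrite gf//; apply: fBs; split=> //; rewrite lte_fin.
Qed.

Section Continuation.
Variables (R : realType) (V : finType) (G : network R V) (S : {set V}).
Variables (mu sigma : V -> R) (p lambda : R).
Hypotheses (hcoef : boundary_coefficients G S mu sigma).
Hypotheses (hp : 0 < p - 1) (hp1 : p - 1 < 1) (hlambda : 0 < lambda).
Variables (u0 : V -> R) (T T0 K : R) (u : V -> R -> R).
Hypothesis hu : solves_on G S mu sigma p (p - 1) lambda u0 T%:E u.
Hypotheses (T00 : 0 <= T0) (T0T : T0 < T) (K0 : 0 <= K).
Hypothesis uK : forall x t, x \in S -> T0 < t -> t < T -> `|u x t| <= K.

Let Fld := field G S mu sigma p lambda.
Let l x := lim (u x t @[t --> T^'-]).

Let u_deriv x t : x \in S -> 0 < t -> t < T ->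
  is_derive t 1 (u x) (Fld (u ^~ t) x).
Proof. by move=> xS t0 tT; exact: (solution_is_derive hcoef hp hu). Qed.

Let u_cvg x : x \in S -> u x t @[t --> T^'-] --> l x.
Proof.
move=> xS; have [M M0 FM] := field_bound hcoef hp hlambda K0.
apply: (@left_limit _ _ (fun t => Fld (u ^~ t) x) T0 T K M) => //.
- by move=> t t1 t2; apply: u_deriv => //; exact: le_lt_trans t1.
- by move=> t t1 t2; exact: uK.
by move=> t t1 t2; apply: FM => y yS; exact: uK.
Qed.

Let lK x : x \in S -> `|l x| <= K.
Proof.
move=> xS; apply: (cvgr_to_le (cvg_norm (u_cvg xS))).
by near=> t; exact: uK.
Unshelve. all: by end_near. Qed.

(** The mean value theorem transfers the limit of the derivative to the
    one-sided expansion at the final time. *)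
Let left_expansion x e : x \in S -> 0 < e -> exists2 d, 0 < d &
  forall s, T - d < s -> s < T ->
    `|u x s - l x - (s - T) * Fld l x| <= e * `|s - T|.
Proof.
move=> xS e0.
have Fl : Fld (u ^~ t) x @[t --> T^'-] --> Fld l x.
  by apply: (@field_cvg _ _ _ _ _ _ _ _ hcoef hp _ _ _ (fun t => u ^~ t)).
have [d d0 dP] : exists2 d, 0 < d & forall c, T - d < c -> c < T ->
    T0 < c /\ `|Fld (u ^~ c) x - Fld l x| <= e.
  apply: near_leftP; near=> c; split; first by near: c; exact: nbhs_left_gt.
  by near: c; exact: (cvgr_distC_le _ _ Fl).
exists d => // s ds sT.
have lim : `|u x t - u x s - (t - s) * Fld l x| - e * (t - s) @[t --> T^'-]
    --> `|l x - u x s - (T - s) * Fld l x| - e * (T - s).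
  have tT : t - s @[t --> T^'-] --> T - s.
    by apply: cvgB; [exact: cvg_at_left_filter|exact: cvg_cst].
  apply: cvgB; last by apply: cvgM => //; exact: cvg_cst.
  apply: cvg_norm; apply: cvgB; last by apply: cvgM => //; exact: cvg_cst.
  by apply: cvgB; [exact: u_cvg|exact: cvg_cst].
rewrite [`|s - T|]distrC [`|T - s|]ger0_norm ?subr_ge0 ?(ltW sT)//.
have -> : u x s - l x - (s - T) * Fld l x
  = - (l x - u x s - (T - s) * Fld l x) by ring.
rewrite normrN -subr_le0; apply: (cvgr_to_le lim); near=> t.
have st : s < t by near: t; exact: nbhs_left_gt.
have tT : t < T by near: t; exact: nbhs_left_lt.
have [T0s _] := dP s ds sT.
have pos c : s <= c -> 0 < c.
  by move=> sc; apply: le_lt_trans T00 _; exact: lt_le_trans sc.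
have der c : c \in `[s, t] -> is_derive c 1 (u x) (Fld (u ^~ c) x).
  rewrite in_itv/= => /andP[sc ct]; apply: u_deriv => //; first exact: pos.
  exact: le_lt_trans tT.
have cont : {within `[s, t], continuous (u x)}.
  by apply: derivable_within_continuous => c /der [].
have der_oo c : c \in `]s, t[ -> is_derive c 1 (u x) (Fld (u ^~ c) x).
  by move=> /subset_itv_oo_cc; exact: der.
have [c + ->] := MVT_segment (ltW st) der_oo cont.
rewrite in_itv/= => /andP[sc ct].
rewrite mulrC -mulrBr normrM gtr0_norm ?subr_gt0// subr_le0 mulrC.
rewrite ler_wpM2r ?subr_ge0 ?(ltW st)//.
by have [] := dP c (lt_le_trans ds sc) (le_lt_trans ct tT).
Unshelve. all: by end_near. Qed.

(** The restart is run with the field truncated at level [K + 1]; since the speed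
    is at most [M], the truncation is not felt during a time [(M + 1)^-1]. *)
Let restart : exists tau w, [/\ 0 < tau, w 0 = l,
  forall s x, 0 <= s -> s < tau -> x \in S -> `|w s x| <= K + 1 &
  forward_solution (Fld \o clamp (K + 1)) w].
Proof.
have K1 : 0 <= K + 1 by rewrite addr_ge0.
have [M M0 FM] := field_bound hcoef hp hlambda K1.
have Fb v x : `|Fld (clamp (K + 1) v) x| <= M.
  by apply: FM => y _; exact: norm_clamp_le.
have Fc := @field_clamp_continuous _ _ G S _ _ _ lambda hcoef hp (K + 1).
have [w [w0 wF wM]] := peano l Fb Fc.
have M1 : 0 < M + 1 by rewrite ltr_wpDl.
exists (M + 1)^-1, w; split; rewrite ?invr_gt0// => s x s0 st xS.
rewrite -[w s x](subrK (l x)) (le_trans (ler_normD _ _))// addrC lerD ?lK//.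
rewrite (le_trans (wM s x s0))//; move: st; rewrite -div1r ltr_pdivlMr//.
by lra.
Qed.

(** The restarted solution is glued on [S] only; on the boundary both pieces are
    p-means of the glued interior values, which makes them match and makes them
    differentiable across time [T]. *)
Lemma solution_extends : exists (T' : R) (v : V -> R -> R),
  [/\ T < T', solves_on G S mu sigma p (p - 1) lambda u0 T'%:E v
    & forall x t, x \in nclosure G S -> time_interval T%:E t ->
        v x t = u x t].
Proof.
have [tau [w [tau0 w0 wK wF]]] := restart.
have Tpos : 0 < T by exact: le_lt_trans T0T.
pose g x t := if t < T then u x t else w (t - T) x.
pose v x t := fill G S mu sigma p (g ^~ t) x.
have g_left t : t < T -> g ^~ t = u ^~ t.
  by move=> tT; apply/funext => x; rewrite /g tT.
have g_right t : T <= t -> g ^~ t = w (t - T).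
  by move=> Tt; apply/funext => x; rewrite /g ltNge Tt.
have v_in x : x \in S -> v x = g x.
  by move=> xS; apply/funext => t; rewrite /v /fill xS.
have vu x t : x \in nclosure G S -> time_interval T%:E t -> v x t = u x t.
  move=> xC [t0 tT]; rewrite lte_fin in tT.
  have tI : time_interval T%:E t by split=> //; rewrite lte_fin.
  by rewrite /v g_left//; have := solution_fill hcoef hp hu tI xC.
have w_field s x : 0 <= s -> s < tau ->
    Fld (clamp (K + 1) (w s)) x = Fld (w s) x.
  move=> s0 st; rewrite /Fld; congr (_ x).
  apply: (@eq_field _ _ G S mu sigma p lambda) => y yS.
  by rewrite clamp_id ?wK.
have dg x t : x \in S -> 0 < t -> t < T + tau ->
    is_derive t 1 (g x) (Fld (g ^~ t) x).
  move=> xS t0 tT'; have [tT|Tt] := ltP t T.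
    rewrite g_left//.
    have e : \forall s \near t, u x s = g x s.
      near=> s; rewrite /g ifT//; near: s; exact: lt_nbhsl.
    exact: (near_eq_is_derive e (u_deriv xS t0 tT)).
  have s0 : 0 <= t - T by rewrite subr_ge0.
  have st : t - T < tau by rewrite ltrBlDl.
  apply: is_derive_expansion => e e0.
  have [d1 d10 right] := wF (t - T) x e s0 e0.
  have {}right s : T <= s -> `|s - t| < d1 ->
      `|g x s - g x t - (s - t) * Fld (g ^~ t) x| <= e * `|s - t|.
    move=> Ts sd; have := right (s - T); rewrite subr_ge0 Ts.
    have -> : s - T - (t - T) = s - t by ring.
    move=> /(_ isT sd) /=; rewrite w_field//.
    by rewrite (g_right _ Tt) /g !ltNge Ts Tt.
  move: Tt; rewrite le_eqVlt => /predU1P[tE|Tt]; last first.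
    exists (Num.min d1 (t - T)); first by rewrite lt_min d10 subr_gt0.
    move=> s; rewrite lt_min => /andP[sd1 sT]; apply: right => //.
    by move: sT; rewrite ltr_norml => /andP[+ _]; lra.
  have [d2 d20 left] := left_expansion xS e0.
  exists (Num.min d1 d2); first by rewrite lt_min d10.
  move=> s; rewrite lt_min => /andP[sd1 sd2].
  have [sT|Ts] := ltP s T; last exact: right.
  have gT : g ^~ t = l by rewrite g_right -tE// subrr w0.
  rewrite gT -[g x t]/((g ^~ t) x) gT -tE {1}/g sT; apply: left => //.
  by move: sd2; rewrite -tE ltr_norml => /andP[+ _]; lra.
have dv x t : x \in nclosure G S -> 0 < t -> t < T + tau -> derivable (v x) t 1.
  rewrite mem_nclosure; have [xS _|xS /= xB] := boolP (x \in S) => t0 tT'.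
    by rewrite v_in//; have [] := dg x t xS t0 tT'.
  have -> : v x = fun s => pmean (p - 1) (bweight G S mu sigma x)
      ((fun o r => bvalue S (g ^~ r) o) ^~ s).
    by apply/funext => s; rewrite /v /fill (negbTE xS).
  apply: pmean_derivable => //; first exact: bweight_is_weight.
  case=> [y|] /=; last exact: derivable_cst.
  case: (boolP (y \in S)) => yS; last exact: derivable_cst.
  by have [] := dg y t yS t0 tT'.
exists (T + tau), v; split => //; first by rewrite ltrDl.
have [reg _ _ init] := hu.
split.
- move=> x xC; split; last by move=> t t0; rewrite lte_fin => tT'; exact: dv.
  apply: (@continuous_time_interval _ (u x) _ T) => //.
  + by have [] := reg x xC.
  + by move=> t t0 tT; apply: vu => //; split => //; rewrite lte_fin.
  + by move=> t; exact: dv.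
- move=> x t xS t0; rewrite lte_fin => tT'.
  have gd := dg x t xS t0 tT'.
  by rewrite v_in// derive1E derive_val /Fld /field xS.
- by move=> z t zB _; exact: fill_boundary.
- by move=> x xC; rewrite vu ?init//; split; rewrite ?lte_fin.
Unshelve. all: by end_near. Qed.

End Continuation.

(** * The energy inequality *)

Lemma is_derive_sumr (R : realType) (I : finType) (P : pred I)
    (f : I -> R -> R) (df : I -> R) (t : R) :
  (forall i, P i -> is_derive t 1 (f i) (df i)) ->
  is_derive t 1 (fun s => \sum_(i | P i) f i s) (\sum_(i | P i) df i).
Proof.
move=> fd.
have -> : (fun s => \sum_(i | P i) f i s) = \sum_(i | P i) f i.
  by apply/funext => s; rewrite fct_sumE.
by elim/big_ind2 : _ => // [|] *; [exact: is_derive_cst|exact: is_deriveD].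
Qed.

Section Energy.
Variables (R : realType) (V : finType) (G : network R V) (S : {set V}).
Variables (mu sigma : V -> R) (p : R).
Hypotheses (hcoef : boundary_coefficients G S mu sigma).
Hypotheses (hp : 0 < p - 1) (hp1 : p - 1 < 1).
Implicit Types (u : V -> R) (x y z : V).

Let C := nclosure G S.
Let cw := cweight G S.

Lemma sum_nclosure (f : V -> R) :
  \sum_(x in C) f x = \sum_(x in S) f x + \sum_(z in nboundary G S) f z.
Proof.
rewrite (bigID (mem S))/=; congr (_ + _); apply: eq_bigl => x.
  by rewrite mem_nclosure; case: (x \in S); rewrite ?andbF.
rewrite mem_nclosure; have [xB|] := boolP (x \in nboundary G S).
  by rewrite orbT (nboundary_notin xB).
by case: (x \in S).
Qed.

Lemma normr_powR_p a : `|a| `^ p = spow (p - 1) a * a :> R.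
Proof. by rewrite spow_mul_self// subrK. Qed.

(** Green's formula.  The double sum is antisymmetrised, then split into interior
    and boundary vertices; no edge joins two boundary vertices. *)
Lemma green u :
  2^-1 * (\sum_(x in C) \sum_(y in C) `|u x - u y| `^ p * cw x y)
  = - (\sum_(x in S) u x * plaplacian G S p u x)
    + \sum_(z in nboundary G S) u z * pnormal_derivative G S p u z.
Proof.
pose A x y := spow (p - 1) (u x - u y) * cw x y.
have Aanti x y : A y x = - A x y.
  by rewrite /A -[u y - u x]opprB spowN mulNr /cw cweight_sym.
have -> : \sum_(x in C) \sum_(y in C) `|u x - u y| `^ p * cw x y
  = \sum_(x in C) \sum_(y in C) u x * A x y
    + \sum_(x in C) \sum_(y in C) u x * A x y.
  rewrite [X in _ + X]exchange_big/= -big_split/=; apply: eq_bigr => x _.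
  rewrite -big_split/=; apply: eq_bigr => y _.
  by rewrite [A y x]Aanti normr_powR_p /A; ring.
rewrite -mulr2n -[X in _ * X]mulr_natl mulrA mulVf ?pnatr_eq0// mul1r.
rewrite sum_nclosure -sumrN; congr (_ + _); apply: eq_bigr => x xS.
  by rewrite plaplacianE mulrN opprK mulr_sumr.
rewrite -mulr_sumr pnormal_derivativeE; congr (_ * _).
rewrite sum_nclosure -[RHS]addr0; congr (_ + _); rewrite big1// => y yB.
rewrite /A /cw /cweight (negbTE (nboundary_notin xS)).
by rewrite (negbTE (nboundary_notin yB)) mulr0.
Qed.

(** Where [mu] vanishes the boundary condition forces [u] to vanish. *)
Lemma boundary_term u z : z \in nboundary G S ->
  mu z * pnormal_derivative G S p u z
    + sigma z * (`|u z| `^ (p - 2) * u z) = 0 ->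
  (z \notin Gamma G S mu -> u z = 0) /\
  u z * pnormal_derivative G S p u z
    = - (if 0 < mu z then sigma z / mu z * `|u z| `^ p else 0).
Proof.
move=> zB; have [mu0 _ pos] := hcoef zB; rewrite spow_p_sub2 => bc.
have [mupos|mupos] := ltP 0 (mu z).
  split; first by move=> zG; rewrite finset.inE zB mupos in zG.
  have e : mu z * pnormal_derivative G S p u z
      = - (sigma z * spow (p - 1) (u z)) by apply/eqP; rewrite -addr_eq0 bc.
  rewrite normr_powR_p; apply: (mulfI (lt0r_neq0 mupos)).
  by rewrite mulrCA e; field; rewrite lt0r_neq0.
have mz : mu z = 0 by apply/le_anti; rewrite mupos.
rewrite mz mul0r !add0r in bc pos.
have uz : u z = 0.
  apply: (inc_inj (ler_spow hp)); rewrite spow0; apply/eqP.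
  by move/eqP: bc; rewrite mulf_eq0 (gt_eqF pos).
by rewrite uz mul0r oppr0.
Qed.

(** By Green's formula and the boundary condition, the right-hand side is the
    numerator of the Rayleigh quotient of [u]. *)
Lemma rayleigh_bound u : (exists2 x, x \in S & u x != 0) ->
  (forall z, z \in nboundary G S -> mu z * pnormal_derivative G S p u z
    + sigma z * (`|u z| `^ (p - 2) * u z) = 0) ->
  first_eigenvalue G S mu sigma p * \sum_(x in S) `|u x| `^ p
    <= - \sum_(x in S) u x * plaplacian G S p u x.
Proof.
move=> [x xS ux] bc.
have den0 : 0 < \sum_(x in S) `|u x| `^ p.
  rewrite (bigD1 x)//= ltr_wpDr ?powR_gt0 ?normr_gt0//.
  by apply: sumr_ge0 => y _; rewrite powR_ge0.
rewrite -ler_pdivlMr//; apply: ge_inf.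
  exists 0 => _ [w _ <-]; apply: divr_ge0; last first.
    by apply: sumr_ge0 => y _; rewrite powR_ge0.
  apply: addr_ge0.
    rewrite mulr_ge0//; apply: sumr_ge0 => a _; apply: sumr_ge0 => b _.
    by rewrite mulr_ge0 ?powR_ge0 ?cweight_ge0.
  apply: sumr_ge0 => z; rewrite finset.inE => /andP[/hcoef[mu0 s0 _] _].
  by rewrite mulr_ge0 ?powR_ge0// divr_ge0.
exists u; first split; first by exists x.
  by move=> z zB; have [] := boundary_term zB (bc z zB).
rewrite /rayleigh; congr (_ / _); rewrite green -addrA.
rewrite (eq_bigr _ (fun z zB => (boundary_term zB (bc z zB)).2)) sumrN.
suff -> : \sum_(z in Gamma G S mu) sigma z / mu z * `|u z| `^ p
  = \sum_(z in nboundary G S)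
      (if 0 < mu z then sigma z / mu z * `|u z| `^ p else 0).
  by rewrite addNr addr0.
by rewrite -big_mkcondr; apply: eq_bigl => z; rewrite finset.inE.
Qed.

(** Comparison of norms: [|.|_2 <= |.|_p] for [p <= 2]. *)
Lemma sum_sqr_powR_le u :
  (\sum_(x in S) u x ^+ 2) `^ (p / 2) <= \sum_(x in S) `|u x| `^ p.
Proof.
set Y := \sum_(x in S) u x ^+ 2.
have p0 : 0 < p by rewrite (lt_trans ltr01)// -subr_gt0.
have Y0 : 0 <= Y by apply: sumr_ge0 => x _; rewrite sqr_ge0.
move: (Y0); rewrite le_eqVlt => /predU1P[<-|Ypos].
  rewrite powR0; last by rewrite gt_eqF// divr_gt0.
  by apply: sumr_ge0 => x _; rewrite powR_ge0.
have split1 a : 0 <= a -> a = a `^ (p / 2) * a `^ (1 - p / 2).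
  by move=> a0; rewrite -powRD subrKC ?oner_eq0// powRr1.
rewrite -(ler_pM2r (powR_gt0 (1 - p / 2) Ypos)) -split1// mulr_suml.
apply: ler_sum => x xS; rewrite [leLHS]split1 ?sqr_ge0//.
have -> : `|u x| `^ p = (u x ^+ 2) `^ (p / 2).
  by rewrite -real_normK ?num_real// -powR_mulrn// -powRrM; congr powR; field.
rewrite ler_wpM2l ?powR_ge0// ge0_ler_powR ?nnegrE ?sqr_ge0//.
  by have := hp1; lra.
by rewrite /Y (bigD1 x)//= lerDl; apply: sumr_ge0 => y _; rewrite sqr_ge0.
Qed.

End Energy.

(** [y `^ (1 - a)] decreases at a rate bounded away from [0], so it cannot stay
    nonnegative. *)
Lemma finite_extinction (R : realType) (y dy : R -> R) (t0 k a : R) :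
  0 < k -> a < 1 ->
  (forall t, t0 <= t -> 0 < y t) ->
  (forall t, t0 <= t -> is_derive t 1 y (dy t)) ->
  (forall t, t0 <= t -> dy t <= - k * y t `^ a) -> False.
Proof.
move=> k0 a1 ypos yd dyk.
pose h t := y t `^ (1 - a); pose dh t := (1 - a) * y t `^ (- a) * dy t.
have hd t : t0 <= t -> is_derive t 1 h (dh t).
  move=> tt0; have := yd t tt0 => ydt.
  have := is_derive1_powR (1 - a) (ypos t tt0) => pd.
  have := @is_derive1_comp R (fun z => z `^ (1 - a)) y t _ _ pd ydt.
  by rewrite /dh (_ : 1 - a - 1 = - a); last ring.
have b0 : 0 < (1 - a) * k by rewrite mulr_gt0// subr_gt0.
have dhk t : t0 <= t -> dh t <= - ((1 - a) * k).
  move=> tt0; have yt := ypos t tt0; rewrite /dh.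
  have c0 : 0 <= (1 - a) * y t `^ (- a).
    by rewrite mulr_ge0 ?powR_ge0// subr_ge0 ltW.
  rewrite (le_trans (ler_wpM2l c0 (dyk t tt0)))//.
  rewrite powRN le_eqVlt; apply/orP; left; apply/eqP; field.
  by rewrite gt_eqF// powR_gt0.
pose t1 := t0 + (h t0 + 1) / ((1 - a) * k).
have h0 t : 0 <= h t by exact: powR_ge0.
have t01 : t0 < t1 by rewrite ltrDl divr_gt0// ltr_wpDl.
have cont : {within `[t0, t1], continuous h}.
  apply: derivable_within_continuous => t.
  by rewrite in_itv/= => /andP[/hd []].
have hoo t : t \in `]t0, t1[ -> is_derive t 1 h (dh t).
  by rewrite in_itv/= => /andP[/ltW/hd].
have [c + hE] := MVT t01 hoo cont.
rewrite in_itv/= => /andP[/ltW tc _].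
have : h t1 - h t0 <= - (h t0 + 1).
  rewrite hE (_ : h t0 + 1 = (1 - a) * k * (t1 - t0)).
    by rewrite -mulNr ler_wpM2r ?dhk// subr_ge0 ltW.
  by rewrite /t1 addrAC subrr add0r mulrC divfK// gt_eqF.
by have := h0 t1; lra.
Qed.

(** * Decay of the energy and extinction *)

Section Decay.
Variables (R : realType) (V : finType) (G : network R V) (S : {set V}).
Variables (mu sigma : V -> R) (p lambda : R) (u0 : V -> R) (T : \bar R).
Variables (u : V -> R -> R).
Hypotheses (hcoef : boundary_coefficients G S mu sigma).
Hypotheses (hp : 0 < p - 1) (hp1 : p - 1 < 1).
Hypothesis hu : solves_on G S mu sigma p (p - 1) lambda u0 T u.

Definition energy t := \sum_(x in S) u x t ^+ 2.

Let gap := first_eigenvalue G S mu sigma p - lambda.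

Definition denergy t :=
  \sum_(x in S) 2 * (u x t * field G S mu sigma p lambda (u ^~ t) x).

Lemma energy_ge0 t : 0 <= energy t.
Proof. by apply: sumr_ge0 => x _; rewrite sqr_ge0. Qed.

Lemma is_derive_energy t : 0 < t -> (t%:E < T)%E ->
  is_derive t 1 energy (denergy t).
Proof.
move=> t0 tT; apply: is_derive_sumr => x xS.
have ud := solution_is_derive hcoef hp hu xS t0 tT.
have -> : (fun s => u x s ^+ 2) = u x * u x.
  by apply/funext => s; rewrite expr2.
apply: is_derive_eq; change (?a *: ?b) with (a * b).
by rewrite mulr_natl mulr2n.
Qed.

Lemma denergy_le t : 0 <= gap -> 0 < t -> (t%:E < T)%E ->
  denergy t <= - (2 * gap) * energy t `^ (p / 2).
Proof.
move=> gap0 t0 tT; have tI : time_interval T t by split => //; exact: ltW.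
have [_ _ bc _] := hu.
have key : denergy t <= - (2 * gap) * \sum_(x in S) `|u x t| `^ p.
  have [nz|z] := pselect (exists2 x, x \in S & u x t != 0); last first.
    have u_0 x : x \in S -> u x t = 0.
      by move=> xS; apply: contra_notP z => /eqP; exists x.
    rewrite /denergy !big1 ?mulr0// => x xS; rewrite u_0// ?mul0r ?mulr0//.
    by rewrite normr_powR_p// mulr0.
  have := rayleigh_bound hcoef hp nz (fun z zB => bc z t zB tI).
  set E := \sum_(x in S) _ `^ _; set D := \sum_(x in S) _ => ray.
  have -> : denergy t = 2 * (D + lambda * E).
    rewrite mulrDr /D /E mulr_sumr [lambda * _]mulr_sumr mulr_sumr -big_split/=.
    apply: eq_bigr => x xS; rewrite (field_solution hcoef hp hu xS tI).
    by rewrite normr_powR_p//; ring.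
  by rewrite /gap; lra.
apply: (le_trans key); rewrite !mulNr lerN2 ler_wpM2l ?mulr_ge0//.
exact: sum_sqr_powR_le.
Qed.

Lemma energy_nonincreasing s t : 0 <= gap -> 0 < s -> s <= t ->
  (t%:E < T)%E -> energy t <= energy s.
Proof.
move=> gap0 s0 st tT.
have der r : r \in `[s, t] -> is_derive r 1 energy (denergy r).
  rewrite in_itv/= => /andP[sr rt]; apply: is_derive_energy.
    exact: lt_le_trans sr.
  by apply: le_lt_trans tT; rewrite lee_fin.
have cont : {within `[s, t], continuous energy}.
  by apply: derivable_within_continuous => r /der [].
have der_oo r : r \in `]s, t[ -> is_derive r 1 energy (denergy r).
  by move=> /subset_itv_oo_cc; exact: der.
have [r + eE] := MVT_segment st der_oo cont.
rewrite in_itv/= => /andP[sr rt]; rewrite -subr_le0 eE.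
rewrite mulr_le0_ge0 ?subr_ge0//.
have rT : (r%:E < T)%E by apply: le_lt_trans tT; rewrite lee_fin.
rewrite (le_trans (denergy_le gap0 (lt_le_trans s0 sr) rT))//.
by rewrite mulNr oppr_le0 mulr_ge0 ?powR_ge0// mulr_ge0.
Qed.

Lemma norm_le_energy x t : x \in S -> `|u x t| <= energy t + 1.
Proof.
move=> xS; have : u x t ^+ 2 <= energy t.
  rewrite /energy (bigD1 x)//= lerDl.
  by apply: sumr_ge0 => y _; rewrite sqr_ge0.
rewrite -real_normK ?num_real//; have := normr_ge0 (u x t).
by nra.
Qed.

End Decay.

Theorem theorem3p16 (R : realType) (V : finType) (G : network R V)
    (S : {set V}) (hS : connected_subgraph G S)
    (mu sigma : V -> R) (hcoef : boundary_coefficients G S mu sigma)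
    (p q lambda : R) (hlambda : 0 < lambda)
    (hp : 0 < p - 1) (hpq : p - 1 = q) (hq : q < 1)
    (hsigma : exists2 z, z \in nboundary G S & sigma z != 0)
    (hlt : lambda < first_eigenvalue G S mu sigma p)
    (u0 : V -> R) (hu0 : forall x, x \in nclosure G S -> 0 <= u0 x)
    (Tmax : \bar R) (u : V -> R -> R)
    (hu : is_solution G S mu sigma p q lambda u0 Tmax u) :
  vanishes_in_finite_time S Tmax u.
Proof.
subst q; have [T0 sol maximal] := hu.
have gap0 : 0 < first_eigenvalue G S mu sigma p - lambda by rewrite subr_gt0.
case: Tmax => [T||//] in hu T0 sol maximal *.
  (* A bound is needed near [T] only, so the energy is compared with its value
     at [T / 2]. *)
  rewrite lte_fin in T0; case: maximal.
  have [lo hi] : 0 < T / 2 /\ T / 2 < T by split; lra.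
  have K0 : 0 <= energy S u (T / 2) + 1 by rewrite addr_ge0// energy_ge0.
  have uK x t : x \in S -> T / 2 < t -> t < T ->
      `|u x t| <= energy S u (T / 2) + 1.
    move=> xS t1 t2; rewrite (le_trans (norm_le_energy _ _ xS))// lerD2r.
    apply: (energy_nonincreasing hcoef hp hq sol (ltW gap0) lo (ltW t1)).
    by rewrite lte_fin.
  have [T' [v [TT' solv vu]]] := solution_extends hcoef hp hq hlambda sol
    (ltW lo) hi K0 uK.
  by exists T'%:E, v; rewrite lte_fin.
apply: contrapT => never.
have pos t : 0 < t -> 0 < energy S u t.
  move=> t0; rewrite lt_neqAle energy_ge0 andbT; apply/eqP => e.
  by apply: never; exists t; split; rewrite ?ltry.
have pos1 t : 1 <= t -> 0 < t by apply: lt_le_trans.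
apply: (@finite_extinction R (energy S u)
  (denergy G S mu sigma p lambda u) 1
  (2 * (first_eigenvalue G S mu sigma p - lambda)) (p / 2)).
- by rewrite mulr_gt0.
- by lra.
- by move=> t /pos1; exact: pos.
- by move=> t /pos1 t0; apply: (is_derive_energy hcoef hp sol); rewrite ?ltry.
- move=> t /pos1 t0; apply: (denergy_le hcoef hp hq sol) => //; first exact: ltW.
  by rewrite ltry.
Qed.
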